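(* Let $I \subseteq R=\Bbbk[x_1,\dots,x_n]$ be a monomial ideal of linear-power type. Suppose that $\{v_1,\dots,v_r\}$ are the vertices of $\mathrm{SP}(I)$. Let $d_i$ be the least common multiple of the denominators of the coordinates of $v_i$, for $i = 1,\dots,r$. Set $D = \max\{d_1,\dots,d_r\}$. Then $$\mathrm{sgt}(I) \le \max\{\ell_s(I) D - 1,\ D\}.$$
   Context: $\Bbbk$ is a field, $R = \Bbbk[x_1,\dots,x_n]$, $\mathfrak{m} = (x_1,\dots,x_n)$, and $\mathbb{N}$ denotes the positive integers. For $\mathbf{a} \in \mathbb{Z}^n_{\ge 0}$, $x^{\mathbf a} = x_1^{a_1}\cdots x_n^{a_n}$. A monomial ideal $I$ is of linear-power type if $I = \bigcap_{\mathfrak{p}\in \mathrm{Min}(I)} \mathfrak{p}^{\omega_{\mathfrak p}}$ with $\omega_{\mathfrak p} \in \mathbb{N}$ and all minimal primes of $I$ monomial primes (generated by subsets of the variables); squarefree monomial ideals are of this type. The $k$-th symbolic power is $I^{(k)} = \bigcap_{\mathfrak{p} \in \mathrm{Ass}(I)} (I^k R_{\mathfrak{p}} \cap R)$, where $\mathrm{Ass}(I)$ is the set of associated primes of $R/I$. The Newton polyhedron $\mathrm{NP}(I)$ is the convex hull in $\mathbb{R}^n$ of $\{\mathbf{a} \in \mathbb{Z}^n_{\ge 0} : x^{\mathbf{a}} \in I\}$. The symbolic polyhedron is $\mathrm{SP}(I) = \bigcap_{\mathfrak{p} \in \mathrm{maxAss}(I)} \mathrm{NP}(R \cap I R_{\mathfrak{p}})$,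 where $\mathrm{maxAss}(I)$ is the set of maximal elements of $\mathrm{Ass}(I)$ (read as $\mathbb{R}^n_{\ge 0}$ if $I=R$); it is a rational polyhedron. The symbolic Rees algebra is $\mathcal{R}_s(I) = \bigoplus_{k\ge 0} I^{(k)}t^k \subseteq R[t]$, with $I^{(0)}=R$, and the symbolic analytic spread is $\ell_s(I) = \dim (\mathcal{R}_s(I)/\mathfrak{m}\mathcal{R}_s(I))$. The symbolic generation type $\mathrm{sgt}(I) = \inf\{d \in \mathbb{N}: \mathcal{R}_s(I) = R[It, I^{(2)}t^2,\dots,I^{(d)}t^d]\}$ is the maximum generating degree of $\mathcal{R}_s(I)$. *)

(* Defs.v *)
From HB Require Import structures.
From mathcomp Require Import all_boot all_order all_algebra.
From mathcomp Require Import mathcomp_extra boolp classical_sets reals ereal.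
From mathcomp Require Import convex.
(* The notations of mpoly clash with those of MathComp-Analysis. *)
From mathcomp Require Export -(notations) mpoly.

Set Implicit Arguments.
Unset Strict Implicit.
Unset Printing Implicit Defensive.

Import Order.TTheory GRing.Theory Num.Theory.
Local Open Scope classical_set_scope.
Local Open Scope ring_scope.

Notation "{ 'mpoly' K [ n ] }" := (mpoly n K)
  (at level 0, K, n at level 2, format "{ 'mpoly'  K [ n ] }") : type_scope.

(* Ideals and primes are taken inside a subring A of an ambient ring B, so that
   they make sense for B itself (A = setT) and for the symbolic Rees algebra. *)
Section Ideals.
Context (B : comNzRingType).
Implicit Types (A I J P : set B).

Record is_ideal A J : Prop := IsIdeal {
  ideal_sub : J `<=` A;
  ideal0 : J 0;
  idealD : forall a b, J a -> J b -> J (a + b);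
  idealM : forall a b, A a -> J b -> J (a * b)
}.

Definition ideal_gen A (S : set B) : set B := smallest (is_ideal A) S.

Definition is_prime_ideal A P : Prop :=
  [/\ is_ideal A P, ~ P 1 &
      forall a b, A a -> A b -> P (a * b) -> P a \/ P b].

(* dim (A / J): the primes of A / J are the P / J with P a prime of A that
   contains J.  The value is -oo when A / J is the zero ring. *)
Definition krull_dim (R : realType) A J : \bar R :=
  ereal_sup [set l%:R%:E | l in [set l : nat | exists P : nat -> set B,
    (forall i, (i <= l)%N -> is_prime_ideal A (P i) /\ J `<=` P i) /\
    (forall i, (i < l)%N -> P i `<` P i.+1)]].

Definition ideal_mul I J : set B :=
  ideal_gen setT [set a * b | a in I & b in J].

Definition ideal_pow I (k : nat) : set B := iter k (ideal_mul I) setT.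

Definition min_primes I : set (set B) :=
  [set P | [/\ is_prime_ideal setT P, I `<=` P &
     forall Q, is_prime_ideal setT Q -> I `<=` Q -> Q `<=` P -> Q = P]].

(* Ass (B / I): the primes that are annihilators of a class in B / I. *)
Definition ass_primes I : set (set B) :=
  [set P | is_prime_ideal setT P /\ exists x, P = [set a | I (a * x)]].

Definition max_ass_primes I : set (set B) :=
  [set P | ass_primes I P /\
     forall Q, ass_primes I Q -> P `<=` Q -> Q = P].

End Ideals.

Section Localization.
Context (B : idomainType).

(* The extension I B_P of I to the localization B_P, inside the fraction field
   of B. *)
Definition loc_ideal (I P : set B) : set {fraction B} :=
  [set x | exists a s, [/\ I a, ~ P s & x = tofrac a / tofrac s]].

Definition loc_contraction (I P : set B) : set B :=
  @tofrac B @^-1` loc_ideal I P.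

(* With no associated prime (I = B) the intersection is B, and ideal_pow I 0
   is B, so the 0-th symbolic power is B. *)
Definition symb_pow (I : set B) (k : nat) : set B :=
  \bigcap_(P in ass_primes I) loc_contraction (ideal_pow I k) P.

Definition symb_rees (I : set B) : set {poly B} :=
  [set p | forall k, symb_pow I k p`_k].

Definition subalg_gen (S : set {poly B}) : set {poly B} :=
  smallest (fun A : set {poly B} => GRing.subalg_closed (mem A)) S.

Definition symb_gen_type (R : realType) (I : set B) : \bar R :=
  ereal_inf [set d%:R%:E | d in [set d : nat | (0 < d)%N /\
    symb_rees I = subalg_gen [set p | exists k a,
      [/\ (1 <= k <= d)%N, symb_pow I k a & p = a *: 'X^k]]]].

End Localization.

Section Monomial.
Context (K : fieldType) (n : nat).
Implicit Types (I P : set {mpoly K[n]}).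

Definition monomial_ideal I : Prop :=
  exists S : set (multinom n), I = ideal_gen setT [set mpolyX K a | a in S].

Definition var (i : 'I_n) : {mpoly K[n]} := mpolyX K (mnm1 i).

Definition monomial_prime P : Prop :=
  exists A : {set 'I_n}, P = ideal_gen setT [set var i | i in [set` A]].

Definition max_graded_ideal : set {mpoly K[n]} :=
  ideal_gen setT (range var).

Definition linear_power_type I : Prop :=
  (forall P, min_primes I P -> monomial_prime P) /\
  exists w : set {mpoly K[n]} -> nat,
    (forall P, min_primes I P -> (0 < w P)%N) /\
    I = \bigcap_(P in min_primes I) ideal_pow P (w P).

Definition symb_spread (R : realType) I : \bar R :=
  krull_dim R (symb_rees I)
    (ideal_gen (symb_rees I) [set f%:P | f in max_graded_ideal]).

End Monomial.

Section Polyhedra.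
Context (R : realType) (n : nat).

Definition convex_hull (S : set 'rV[R]_n) : set 'rV[R]_n :=
  smallest (@convex_set R 'rV[R]_n) S.

Definition newton_polyhedron (K : fieldType) (I : set {mpoly K[n]}) :
    set 'rV[R]_n :=
  convex_hull [set \row_j (a j)%:R | a in [set a | I (mpolyX K a)]].

(* Newton polyhedra lie in the nonnegative orthant, so the first clause only
   matters when I has no associated prime, i.e. when I is the whole ring. *)
Definition symb_polyhedron (K : fieldType) (I : set {mpoly K[n]}) :
    set 'rV[R]_n :=
  [set u : 'rV[R]_n | forall j, 0 <= u 0 j] `&`
  \bigcap_(P in max_ass_primes I) newton_polyhedron (loc_contraction I P).

(* Vertices are the 0-dimensional faces, a face being cut out by a valid
   inequality. *)
Definition vertices (Q : set 'rV[R]_n) : set 'rV[R]_n :=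
  [set u | exists (c : 'rV[R]_n) (b : R),
    (forall w, Q w -> b <= \sum_j c 0 j * w 0 j) /\
    Q `&` [set w : 'rV[R]_n | \sum_j c 0 j * w 0 j = b] = [set u]].

(* The value 1 on irrational numbers is a dummy. *)
Definition denominator (x : R) : nat :=
  xget 1%N [set `|denq q|%N | q in [set q : rat | ratr q = x]].

Definition lcm_denominators (u : 'rV[R]_n) : nat :=
  \big[lcmn/1%N]_(j < n) denominator (u 0 j).

End Polyhedra.

Arguments newton_polyhedron R {n K} I.
Arguments symb_polyhedron R {n K} I.

(* Main.v *)
Require Import Defs.
From HB Require Import structures.
From mathcomp Require Import all_boot all_order all_algebra.
From mathcomp Require Import mathcomp_extra boolp classical_sets reals ereal.
From mathcomp Require Import interval_inference convex lra ring.

(** Write [C] for the family of subsets of the variables that generate the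
    minimal primes of [I], and [w_A] for the exponents. Then Ass(I) = Min(I),
    and a monomial [x^a] lies in the symbolic power [I^(k)] iff
    [sum_(j in A) a_j >= k w_A] for all [A] in [C], i.e. iff [a] lies in
    [k SP(I)]. The symbolic Rees algebra is thus a semigroup algebra. Let
    [x^a t^k] be one of its minimal generators, [k > D]. As the inequalities
    have 0/1 coefficients and [x^a t^k] is not divisible by a variable, [a/k]
    lies on a compact face of [SP(I)]. Peeling off one vertex after the other
    writes [(a, k)] as [sum_(i < s) t_i (v_i, 1)] along a strictly decreasing
    chain of faces. The monomials outside of a face span a prime of the Rees
    algebra that contains the maximal ideal, so the chain of faces gives
    [s <= l_s(I)]. If some [t_i >= d_i], then [x^(d_i v_i) t^(d_i)] splits off
    [x^a t^k]; otherwise [k = sum t_i < s D]. *)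

Set Implicit Arguments.
Unset Strict Implicit.
Unset Printing Implicit Defensive.

Import Order.TTheory GRing.Theory Num.Theory.
Local Open Scope ring_scope.

(** * Cones given by finitely many inequalities *)

Section Cone.
Context (F : realFieldType) (m : nat) (J : finType) (N : J -> 'cV[F]_m).
Implicit Types (p z g : 'rV[F]_m) (t : J) (T : {set J}).

Definition pairing t p : F := (p *m N t) 0 0.

Definition in_cone p := forall t, 0 <= pairing t p.

Definition tight p : {set J} := [set t | pairing t p == 0]%SET.

Lemma pairingD t p z : pairing t (p + z) = pairing t p + pairing t z.
Proof. by rewrite /pairing mulmxDl mxE. Qed.

Lemma pairingZ t a p : pairing t (a *: p) = a * pairing t p.
Proof. by rewrite /pairing -scalemxAl mxE. Qed.

Lemma pairingN t p : pairing t (- p) = - pairing t p.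
Proof. by rewrite /pairing mulNmx mxE. Qed.

Lemma pairing0 t : pairing t 0 = 0.
Proof. by rewrite /pairing mul0mx mxE. Qed.

Lemma mem_tight t p : (t \in tight p) = (pairing t p == 0).
Proof. by rewrite inE. Qed.

Lemma tightP p t : t \in tight p -> pairing t p = 0.
Proof. by rewrite mem_tight => /eqP. Qed.

Lemma in_coneD p z : in_cone p -> in_cone z -> in_cone (p + z).
Proof. by move=> hp hz t; rewrite pairingD addr_ge0. Qed.

Lemma in_coneZ a p : 0 <= a -> in_cone p -> in_cone (a *: p).
Proof. by move=> ha hp t; rewrite pairingZ mulr_ge0. Qed.

(** The ratio test: go from [p] along [z] until the first of the constraints that decrease along [z]
    becomes tight. It exists as [t0] is one of them, and the others remain nonnegative by minimality
    of the ratio. *)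
Lemma ray_exit p z t0 : in_cone p -> pairing t0 z < 0 ->
  exists a t, [/\ 0 <= a, in_cone (p + a *: z), pairing t z < 0
    & pairing t (p + a *: z) = 0].
Proof.
move=> hp ht0.
pose ratio t := pairing t p / - pairing t z.
pose t := [arg min_(i < t0 | pairing i z < 0) ratio i]%O.
have [tz tmin] : pairing t z < 0 /\ forall i, pairing i z < 0 -> ratio t <= ratio i.
  by rewrite /t; case: Order.TotalTheory.arg_minP => // i hi hmin; split.
have ratio_ge0 : 0 <= ratio t.
  by rewrite /ratio divr_ge0 // oppr_ge0 ltW.
exists (ratio t), t; split => //; last first.
  by rewrite pairingD pairingZ /ratio invrN mulrN mulNr divfK ?subrr // lt_eqF.
move=> i; rewrite pairingD pairingZ.
have [iz|iz] := ltP (pairing i z) 0; last by rewrite addr_ge0 // mulr_ge0.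
have := tmin _ iz; rewrite {2}/ratio ler_pdivlMr ?oppr_gt0 // mulrN.
by rewrite -subr_ge0 opprK.
Qed.

(* Carathéodory by pulling: remove from [p] the largest possible multiple of a
   generator [g] lying on the face of [p]; the remainder lies on a proper
   subface that does not contain [g]. *)
Lemma pulling (G : 'rV[F]_m -> Prop) (T0 : {set J}) p :
  (forall g, G g -> exists t, 0 < pairing t g) ->
  (forall p, in_cone p -> T0 \subset tight p -> p != 0 ->
     exists2 g, G g & tight p \subset tight g) ->
  in_cone p -> T0 \subset tight p ->
  exists (s : seq (F * 'rV[F]_m)) (T : nat -> {set J}),
  [/\ T 0%N = tight p, p = \sum_(x <- s) x.1 *: x.2,
      (forall x, x \in s -> 0 <= x.1 /\ G x.2) &
      forall i, (i < size s)%N -> [/\ T i \subset T i.+1,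
        T i \subset tight (nth (0, 0) s i).2 &
        exists2 t, t \in T i.+1 & pairing t (nth (0, 0) s i).2 != 0]].
Proof.
move=> Gpos Gface.
have [k] := ubnP #|~: tight p|; elim: k p => // k IH p ltk hp hT0.
have [->|p_neq0] := eqVneq p 0.
  exists [::], (fun=> tight 0); split=> //; by rewrite big_nil.
have [g Gg pg] := Gface p hp hT0 p_neq0.
have [t0 t0g] := Gpos _ Gg.
have t0g' : pairing t0 (- g) < 0 by rewrite pairingN oppr_lt0.
have [a [t [a_ge0 hpa tg ta]]] := ray_exit hp t0g'.
set p' := p + _ in hpa ta.
have sub : tight p \subset tight p'.
  apply/fintype.subsetP => i ip; rewrite mem_tight pairingD pairingZ pairingN.
  by rewrite (tightP ip) (tightP (fintype.subsetP pg _ ip)) oppr0 mulr0 addr0.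
(* The blocking constraint is nonzero on [g], so it is not tight at [p]. It gives both the descent
   of the induction and the constraint of the next face that [g] violates. *)
have tp : t \notin tight p.
  apply/negP => /(fintype.subsetP pg)/tightP tg0.
  by move: tg; rewrite pairingN tg0 oppr0 ltxx.
have tp' : t \in tight p' by rewrite mem_tight ta.
have [|s [T [T_0 p'E sG chain]]] := IH p' _ hpa (fintype.subset_trans hT0 sub).
  rewrite ltnS in ltk; apply: leq_trans ltk; apply: proper_card.
  rewrite properE finset.setCS sub /=; apply/fintype.subsetPn; exists t; first by rewrite inE.
  by rewrite inE tp'.
exists ((a, g) :: s), (fun i => if i is i'.+1 then T i' else tight p); split=> //.
- by rewrite big_cons /= -p'E /p' scalerN addrC subrK.
- by move=> x; rewrite inE => /orP[/eqP ->|/sG].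
- case=> [_|i /chain//]; rewrite /= T_0; split=> //.
  exists t => //; apply/eqP => tg0.
  by move: tg; rewrite pairingN tg0 oppr0 ltxx.
Qed.

(** While a nonzero direction keeps the height [h] and all tight constraints, follow it until a new
    constraint becomes tight. Pointedness guarantees a decreasing constraint along it, so the walk
    is stopped; each round enlarges the tight set, and it ends at a vertex. *)
Lemma vertex_of_face (h : J) (T0 : {set J}) p :
  (forall z, (forall t, t \in T0 -> pairing t z = 0) -> pairing h z = 0 ->
     in_cone z -> z = 0) ->
  in_cone p -> T0 \subset tight p -> pairing h p = 1 ->
  exists g, [/\ in_cone g, tight p \subset tight g, pairing h g = 1 &
    forall z, (forall t, t \in tight g -> pairing t z = 0) -> pairing h z = 0 ->
      z = 0].
Proof.
move=> pointed.
have [k] := ubnP #|~: tight p|; elim: k p => // k IH p ltk hp hT0 ph.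
have [?|/existsNP[z /not_implyP[zp /not_implyP[zh z_neq0]]]] := pselect
  (forall z, (forall t, t \in tight p -> pairing t z = 0) -> pairing h z = 0 -> z = 0).
  by exists p.
have [t0 t0z] : exists t, pairing t z < 0.
  apply: contrapT => /forallNP zge0; apply: z_neq0; apply: pointed => //.
    by move=> t /(fintype.subsetP hT0); exact: zp.
  by move=> t; rewrite leNgt; apply/negP.
have [a [t [a_ge0 hpa tz ta]]] := ray_exit hp t0z.
set p' := p + _ in hpa ta.
have sub : tight p \subset tight p'.
  apply/fintype.subsetP => i ip; rewrite mem_tight pairingD pairingZ.
  by rewrite (tightP ip) zp // mulr0 addr0.
have tp : t \notin tight p.
  by apply/negP => /zp tz0; move: tz; rewrite tz0 ltxx.
have tp' : t \in tight p' by rewrite mem_tight ta.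
have [||g [hg pg gh gker]] := IH p' _ hpa (fintype.subset_trans hT0 sub).
- rewrite ltnS in ltk; apply: leq_trans ltk; apply: proper_card.
  rewrite properE finset.setCS sub /=; apply/fintype.subsetPn; exists t; first by rewrite inE.
  by rewrite inE tp'.
- by rewrite pairingD pairingZ zh mulr0 addr0.
by exists g; split=> //; exact: fintype.subset_trans pg.
Qed.

End Cone.

(* Injectivity of a linear map is a rank condition, hence insensitive to
   extension of scalars. *)
Lemma pairing_map_ker (F L : realFieldType) (f : {rmorphism F -> L}) m
    (J : finType) (N : J -> 'cV[F]_m) (T : {set J}) :
  (forall z, (forall t, t \in T -> pairing N t z = 0) -> z = 0) ->
  forall z, (forall t, t \in T -> pairing (fun t => map_mx f (N t)) t z = 0) ->
    z = 0.
Proof.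
move=> Ninj z zT.
pose M := \matrix_(i < m, l < #|J|)
  if enum_val l \in T then N (enum_val l) i 0 else 0.
have Mfree : row_free M.
  apply: inj_row_free => y /rowP yM; apply: Ninj => t tT.
  have := yM (enum_rank t); rewrite !mxE => <-; rewrite /pairing mxE.
  by apply: eq_bigr => i _; rewrite mxE enum_rankK tT.
rewrite -(row_free_map f) in Mfree; apply: (row_free_inj Mfree).
rewrite mul0mx; apply/rowP => l; rewrite !mxE.
have [lT|lT] := boolP (enum_val l \in T).
  rewrite -[RHS](zT _ lT) /pairing mxE.
  by apply: eq_bigr => i _; rewrite !mxE lT.
by rewrite big1 // => i _; rewrite !mxE (negPf lT) rmorph0 mulr0.
Qed.

Local Open Scope classical_set_scope.

(** * Ideals and supports *)

Section Ideals.
Context (B : comNzRingType).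
Implicit Types (I J P : set B).

Lemma ideal_gen_ideal (S : set B) : is_ideal setT (ideal_gen setT S).
Proof.
split=> //.
- by move=> J [/ideal0].
- by move=> a b Ha Hb J HJ; apply: (idealD HJ.1); [exact: Ha|exact: Hb].
- by move=> a b _ Hb J HJ; apply: (idealM HJ.1) => //; exact: Hb.
Qed.

Lemma ideal_mul_mem I J a b : I a -> J b -> ideal_mul I J (a * b).
Proof. by move=> Ia Jb; apply: sub_gen_smallest; exists a => //; exists b. Qed.

Lemma ideal_mul_sub I J X : is_ideal setT X ->
  (forall a b, I a -> J b -> X (a * b)) -> ideal_mul I J `<=` X.
Proof.
by move=> idX IJX; apply: smallest_sub => // _ [a Ia [b Jb <-]]; exact: IJX.
Qed.

Lemma ideal_pow_ideal I k : is_ideal setT (ideal_pow I k).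
Proof. by case: k => [//|k]; exact: ideal_gen_ideal. Qed.

Lemma ideal_pow1 I : is_ideal setT I -> ideal_pow I 1 = I.
Proof.
move=> [subI I0 ID IM]; apply/seteqP; split.
  by apply: ideal_mul_sub => // a b Ia _; rewrite mulrC; exact: IM.
by move=> a Ia; rewrite -[a]mulr1; exact: ideal_mul_mem.
Qed.

Lemma ideal_sum J (T : Type) (r : seq T) (P : pred T) (f : T -> B) :
  is_ideal setT J -> (forall i, P i -> J (f i)) ->
  J (\sum_(i <- r | P i) f i).
Proof.
move=> [_ J0 JD _] Jf; elim/big_rec: _ => // i x Pi Jx.
by apply: JD => //; exact: Jf.
Qed.

Lemma prime_ideal_prod P (T : finType) (Q : pred T) (f : T -> B) :
  is_prime_ideal setT P -> (forall i, Q i -> ~ P (f i)) ->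
  ~ P (\prod_(i | Q i) f i).
Proof.
move=> [_ P1 PM] Pf; elim/big_rec: _ => // i x Qi Px Pix.
by case: (PM _ _ _ _ Pix) => //; exact: Pf.
Qed.

Lemma prime_ideal_exp P (a : B) k : is_prime_ideal setT P -> P (a ^+ k) -> P a.
Proof.
move=> [_ P1 PM]; elim: k => [|k IH]; first by rewrite expr0 => /P1.
by rewrite exprS => /PM[].
Qed.

End Ideals.


Local Notation "a +m b" := (mnm_add a b) (at level 50, left associativity).
Local Notation X_ m := (mpolyX _ m).

Section Supports.
Context (K : fieldType) (n : nat).
Implicit Types (f g : {mpoly K[n]}) (E F : multinom n -> Prop).

Definition supported E : set {mpoly K[n]} :=
  [set f | forall m, m \in msupp f -> E m].

Lemma supported_ideal E : (forall m m', E m -> E (m' +m m)) ->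
  is_ideal setT (supported E).
Proof.
move=> EM; split=> //.
- by move=> m; rewrite (_ : 0 = mpolyC n 0) ?msupp0 // mpolyC0.
- move=> f g Ef Eg m /msuppD_le; rewrite mem_cat => /orP[]; [exact: Ef|exact: Eg].
- move=> f g _ Eg m /msuppM_le /allpairsP[[m1 m2] [/= _ m2g ->]].
  by apply: EM; exact: Eg.
Qed.

Lemma supported0 E : supported E 0.
Proof. by move=> m; rewrite mcoeff_msupp mcoeff0 eqxx. Qed.

Lemma supportedD E f g : supported E f -> supported E g -> supported E (f + g).
Proof.
by move=> Ef Eg m /msuppD_le; rewrite mem_cat => /orP[]; [exact: Ef|exact: Eg].
Qed.

Lemma supported_sum E (T : Type) (r : seq T) (P : pred T) h :
  (forall i, P i -> supported E (h i)) ->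
  supported E (\sum_(i <- r | P i) h i).
Proof.
move=> Eh; elim/big_rec: _ => [|i x Pi Ex]; first exact: supported0.
by apply: supportedD => //; exact: Eh.
Qed.

Lemma supportedM E1 E2 E f g : (forall m m', E1 m -> E2 m' -> E (m +m m')) ->
  supported E1 f -> supported E2 g -> supported E (f * g).
Proof.
move=> EM Ef Eg m /msuppM_le /allpairsP[[m1 m2] [/= m1f m2g ->]].
by apply: EM; [exact: Ef|exact: Eg].
Qed.

Lemma supportedX E m : supported E (X_ m) <-> E m.
Proof.
split=> [|Em m']; last by rewrite msuppX inE => /eqP ->.
by apply; rewrite msuppX inE.
Qed.

Lemma mem_ideal_monomials (J : set {mpoly K[n]}) f : is_ideal setT J ->
  supported (fun m => J (X_ m)) f -> J f.
Proof.
move=> idJ Jf; rewrite [f]mpolyE big_seq; apply: ideal_sum => // m mf.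
by case: idJ => _ _ _ JM; rewrite -mul_mpolyC; apply: JM => //; exact: Jf.
Qed.

Definition mproj (P : pred (multinom n)) f : {mpoly K[n]} :=
  \sum_(m <- msupp f | P m) mcoeff m f *: X_ m.

Lemma mcoeff_mproj P f m : mcoeff m (mproj P f) = if P m then mcoeff m f else 0.
Proof.
rewrite raddf_sum /= big_mkcond /=.
have [mf|mf] := boolP (m \in msupp f); last first.
  rewrite (memN_msupp_eq0 mf) if_same big1_seq // => m' /andP[_ m'f].
  rewrite mcoeffZ mcoeffX; case: eqVneq => [e|_]; last by rewrite mulr0 if_same.
  by rewrite -e m'f in mf.
rewrite (bigD1_seq m) ?msupp_uniq //= mcoeffZ mcoeffX eqxx mulr1.
rewrite big1 ?addr0 // => m' /negPf m'm.
by rewrite mcoeffZ mcoeffX m'm mulr0 if_same.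
Qed.

Lemma mproj_is_zmod_morphism P : zmod_morphism (mproj P).
Proof.
move=> f g; apply/mpolyP => m; rewrite mcoeffB !mcoeff_mproj mcoeffB.
by case: ifP; rewrite ?subr0.
Qed.

HB.instance Definition _ P := GRing.isZmodMorphism.Build _ _ (mproj P)
  (mproj_is_zmod_morphism P).

Lemma mprojX P c m : mproj P (c *: X_ m) = if P m then c *: X_ m else 0.
Proof.
apply/mpolyP => m'; rewrite mcoeff_mproj; have [<-|mm'] := eqVneq m m'.
  by case: ifP; rewrite ?mcoeff0.
by rewrite !(mcoeffZ, mcoeffX, fun_if (mcoeff _), mcoeff0, negPf mm', mulr0) !if_same.
Qed.

Lemma mproj_eq0 P f : mproj P f = 0 <-> supported (fun m => ~~ P m) f.
Proof.
split=> [f0 m|Pf].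
  rewrite mcoeff_msupp; apply: contraNN => Pm.
  by have := mcoeff_mproj P f m; rewrite f0 Pm mcoeff0 => <-.
by rewrite /mproj big_seq_cond big1 // => m /andP[/Pf/negPf ->].
Qed.

(** Used twice: for the part of lowest degree in some variables, and for the projection of a Rees
    algebra to a face. Restricting the condition to the supports is what the first use relies on. *)
Lemma mproj_mul (P P1 P2 : pred (multinom n)) f g :
  (forall m m', m \in msupp f -> m' \in msupp g -> P (m +m m') = P1 m && P2 m') ->
  mproj P (f * g) = mproj P1 f * mproj P2 g.
Proof.
move=> PM; rewrite mpolyME raddf_sum /= big_allpairs /=.
rewrite [in RHS]/mproj [X in X * _]big_mkcond big_distrl /= big_seq [RHS]big_seq.
apply: eq_bigr => m mf; rewrite [X in _ * X]big_mkcond /= big_distrr /=.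
rewrite big_seq [RHS]big_seq; apply: eq_bigr => m' m'g.
rewrite mprojX PM //; case: (P1 m); case: (P2 m'); rewrite ?mul0r ?mulr0 //=.
by rewrite mpolyXD -scalerAl -scalerAr scalerA.
Qed.

End Supports.

(** * Monomial primes and symbolic powers *)

Section MonomialPrimes.
Context (K : fieldType) (n : nat).
Implicit Types (f g : {mpoly K[n]}) (A : {set 'I_n}) (m : multinom n) (w : nat).

(** The order of [x^m] along the prime generated by the variables in [A]. *)
Definition adeg A m : nat := (\sum_(i in A) m i)%N.

Lemma adegD A m m' : adeg A (m +m m') = (adeg A m + adeg A m')%N.
Proof. by rewrite /adeg -big_split; apply: eq_bigr => i _; rewrite mnmDE. Qed.

Lemma adegMn A m k : adeg A (mnm_muln m k) = (adeg A m * k)%N.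
Proof. by rewrite /adeg big_distrl; apply: eq_bigr => i _; rewrite mulmnE. Qed.

Lemma adeg0 A : adeg A mnm0 = 0%N.
Proof. by rewrite /adeg big1 // => i _; rewrite mnm0E. Qed.

Lemma adeg1 A i : adeg A (mnm1 i) = (i \in A).
Proof.
rewrite /adeg; have [iA|iA] := boolP (i \in A).
  rewrite (bigD1 i) //= mnm1E eqxx big1 // => j /andP[_ /negPf ji].
  by rewrite mnm1E eq_sym ji.
rewrite big1 // => j jA; rewrite mnm1E; case: eqP => // e.
by rewrite e jA in iA.
Qed.

Lemma leq_adeg A m i : i \in A -> (m i <= adeg A m)%N.
Proof. by move=> iA; rewrite /adeg (bigD1 i) //= leq_addr. Qed.

Lemma leq_adegS A A' m : A \subset A' -> (adeg A m <= adeg A' m)%N.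
Proof.
move=> AA'; rewrite /adeg [leqRHS](big_setID A) /= (finset.setIidPr AA').
exact: leq_addr.
Qed.

Lemma adeg_gt0P A m : (0 < adeg A m)%N ->
  exists i m', [/\ i \in A & m = mnm1 i +m m'].
Proof.
rewrite lt0n sum_nat_eq0 => /forallPn[i]; rewrite negb_imply => /andP[iA mi].
exists i, (mnm_sub m (mnm1 i)); split=> //.
by rewrite addmC submK // lep1mP.
Qed.

Lemma adeg_split A m w w' : (w + w' <= adeg A m)%N ->
  exists m1 m2, [/\ m = m1 +m m2, (w <= adeg A m1)%N & (w' <= adeg A m2)%N].
Proof.
elim: w m => [|w IH] m; first by exists mnm0, m; rewrite add0m.
move=> wm; have /adeg_gt0P[i [m' [iA mE]]] : (0 < adeg A m)%N.
  exact: leq_trans wm.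
move: wm; rewrite mE adegD adeg1 iA addSn ltnS => /IH[m1 [m2 [-> w1 w2]]].
by exists (mnm1 i +m m1), m2; rewrite addmA adegD adeg1 iA add1n ltnS.
Qed.

(** The [w]-th power of the prime generated by [A], encoded by exponents so that membership can be
    tested on monomials; [prime_pow_expE] identifies it with the ideal power. *)
Definition prime_pow A w : set {mpoly K[n]} :=
  supported (fun m => (w <= adeg A m)%N).

Lemma prime_pow_ideal A w : is_ideal setT (prime_pow A w).
Proof.
by apply: supported_ideal => m m' wm; rewrite adegD (leq_trans wm) ?leq_addl.
Qed.

Lemma mem0_prime_pow A w : prime_pow A w 0.
Proof. exact: supported0. Qed.

Lemma prime_powMl A w f g : prime_pow A w g -> prime_pow A w (f * g).
Proof. by apply: (idealM (prime_pow_ideal A w)). Qed.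

Lemma prime_powX A w m : prime_pow A w (X_ m) <-> (w <= adeg A m)%N.
Proof. exact: supportedX. Qed.

Lemma prime_pow0 A : prime_pow A 0 = setT.
Proof. by apply/seteqP; split. Qed.

Lemma prime_powM A w w' f g :
  prime_pow A w f -> prime_pow A w' g -> prime_pow A (w + w') (f * g).
Proof. by apply: supportedM => m m' wm w'm'; rewrite adegD leq_add. Qed.

Lemma monomial_primeE A :
  ideal_gen setT [set var K i | i in [set` A]] = prime_pow A 1.
Proof.
apply/seteqP; split.
  apply: smallest_sub; first exact: prime_pow_ideal.
  by move=> _ [i /= iA <-]; apply/prime_powX; rewrite adeg1 iA.
move=> f fA; apply: mem_ideal_monomials; first exact: ideal_gen_ideal.
move=> m /fA /adeg_gt0P[i [m' [iA ->]]]; rewrite mpolyXD mulrC.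
apply: (idealM (ideal_gen_ideal _)) => //.
by apply: sub_gen_smallest; exists i.
Qed.

Lemma prime_pow_expE A w : ideal_pow (prime_pow A 1) w = prime_pow A w.
Proof.
elim: w => [|w IH]; first by rewrite prime_pow0.
rewrite [LHS]/ideal_pow iterS -/(ideal_pow _ w) IH; apply/seteqP; split.
  apply: ideal_mul_sub; first exact: prime_pow_ideal.
  by move=> f g; exact: prime_powM.
move=> f fA; apply: mem_ideal_monomials; first exact: ideal_gen_ideal.
move=> m /fA; rewrite -add1n => /adeg_split[m1 [m2 [-> ? ?]]].
by rewrite mpolyXD; apply: ideal_mul_mem; apply/prime_powX.
Qed.

(** Suppose all terms of [g] have degree at least [d] in [A], with [d < w]. The degree [d] part of
    [f * g] vanishes and equals the degree 0 part of [f], which is nonzero, times the degree [d]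
    part of [g]. In a domain the latter is then 0, so [d] can be raised up to [w]. *)
Lemma prime_pow_primary A w f g :
  ~ prime_pow A 1 f -> prime_pow A w (f * g) -> prime_pow A w g.
Proof.
move=> fA fgA; suff: forall d, (d <= w)%N -> prime_pow A d g by apply.
elim=> [|d IH dw]; first by rewrite prime_pow0.
have gd : prime_pow A d g by apply: IH; exact: ltnW.
have := @mproj_mul K n (fun m => adeg A m == d) (fun m => adeg A m == 0%N)
  (fun m => adeg A m == d) f g.
rewrite (mproj_eq0 _ (f * g)).2; last first.
  by move=> m /fgA wm; rewrite gtn_eqF // (leq_trans dw).
have h : forall m m', m \in msupp f -> m' \in msupp g ->
    (adeg A (m +m m') == d) = (adeg A m == 0)%N && (adeg A m' == d).
  move=> m m' _ /gd; rewrite adegD leq_eqVlt => /orP[/eqP <-|dm'].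
    by rewrite eqxx andbT -{2}[d]add0n eqn_add2r.
  by rewrite (gtn_eqF dm') andbF gtn_eqF // (leq_trans dm') ?leq_addl.
move=> /(_ h) /esym/eqP; rewrite mulf_eq0 => /orP[]/eqP /mproj_eq0 {}h.
  by case: fA => m /h; rewrite lt0n.
by move=> m mg; rewrite ltn_neqAle eq_sym h // gd.
Qed.

Lemma prime_pow_prime A : is_prime_ideal setT (prime_pow A 1).
Proof.
split; first exact: prime_pow_ideal.
  by rewrite -mpolyX0 => /prime_powX; rewrite adeg0.
move=> f g _ _ fg; have [|fA] := pselect (prime_pow A 1 f); first by left.
by right; exact: prime_pow_primary fg.
Qed.

Lemma prime_pow_sub A A' : prime_pow A 1 `<=` prime_pow A' 1 -> A \subset A'.
Proof.
move=> AA'; apply/fintype.subsetP => i iA.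
have /AA'/prime_powX : prime_pow A 1 (X_ (mnm1 i)).
  by apply/prime_powX; rewrite adeg1 iA.
by rewrite adeg1 lt0b.
Qed.

Lemma prime_pow_inj A A' : prime_pow A 1 = prime_pow A' 1 -> A = A'.
Proof.
move=> e; apply/eqP; rewrite finset.eqEsubset.
by apply/andP; split; apply: prime_pow_sub; rewrite e.
Qed.

Lemma prime_pow_exp A w f : prime_pow A 1 f -> prime_pow A w (f ^+ w).
Proof.
move=> fA; elim: w => [|w IH]; first by rewrite prime_pow0.
by rewrite exprS -add1n; exact: prime_powM.
Qed.

End MonomialPrimes.

Definition mnm_of n (E : 'I_n -> nat) : multinom n := Multinom [tuple E i | i < n].

Lemma mnm_ofE n (E : 'I_n -> nat) j : mnm_of E j = E j.
Proof. exact: mnmE. Qed.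

Section LinearPower.
Context (K : fieldType) (n : nat) (I : set {mpoly K[n]}).
Context (C : {set {set 'I_n}}) (w : {set 'I_n} -> nat).
Context (C_antichain : forall A A', A \in C -> A' \in C -> A \subset A' -> A = A').
Context (w_gt0 : forall A, A \in C -> (0 < w A)%N).
Context (IE : I = \bigcap_(A in [set` C]) prime_pow A (w A)).
Implicit Types (f g : {mpoly K[n]}) (A : {set 'I_n}) (m : multinom n) (k : nat).

(** The exponents of the [k]-th symbolic power, as [symb_powE] shows. *)
Definition symb_mon k m : Prop :=
  forall A, A \in C -> (k * w A <= adeg A m)%N.

Lemma symb_monD k k' m m' :
  symb_mon k m -> symb_mon k' m' -> symb_mon (k + k') (m +m m').
Proof. by move=> h h' A CA; rewrite mulnDl adegD leq_add ?h ?h'. Qed.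

Lemma linear_power_ideal : is_ideal setT I.
Proof.
rewrite IE; split=> //.
- by move=> A _; exact: mem0_prime_pow.
- move=> f g If Ig A CA.
  by apply: supportedD; [exact: If|exact: Ig].
- by move=> f g _ Ig A CA; apply: prime_powMl; exact: Ig.
Qed.

Lemma mem_linear_power m : I (X_ m) <-> symb_mon 1 m.
Proof.
rewrite IE; split=> [h A CA|h A CA]; last by apply/prime_powX; rewrite -[w A]mul1n h.
by rewrite mul1n; have /prime_powX := h _ CA.
Qed.

(** A monomial that is a unit at the prime of [A] but lies in the components of [I] at all other
    primes. The exponent, the sum of all [w A'], is a crude common bound. *)
Definition separator A : multinom n :=
  mnm_of (fun j => if j \in A then 0%N else (\sum_(A' in C) w A')%N).

Lemma adeg_separator A : adeg A (separator A) = 0%N.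
Proof. by rewrite /adeg big1 // => i iA; rewrite mnm_ofE iA. Qed.

Lemma leq_separator A A' : A \in C -> A' \in C -> A' != A ->
  (w A' <= adeg A' (separator A))%N.
Proof.
move=> CA A'C A'A; have /fintype.subsetPn[l lA' lA] : ~~ (A' \subset A).
  by apply: contraNN A'A => sub; rewrite (C_antichain A'C CA sub).
apply: leq_trans (leq_adeg _ lA'); rewrite mnm_ofE (negPf lA).
by rewrite (bigD1 A') //= leq_addr.
Qed.

Lemma ideal_pow_linear_power k f A :
  A \in C -> ideal_pow I k f -> prime_pow A (k * w A) f.
Proof.
move=> CA; elim: k f => [|k IH] f; first by rewrite mul0n prime_pow0.
rewrite [ideal_pow _ _]/ideal_pow iterS -/(ideal_pow _ k); move: f.
apply: ideal_mul_sub; first exact: prime_pow_ideal.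
move=> f g If /IH gA; rewrite mulSn; apply: prime_powM => //.
by move: If; rewrite IE; apply.
Qed.

(** Cut [x^m] into factors of degree at least [w A] in [A]; each of them times one copy of the
    separator lies in every component of [I]. *)
Lemma ideal_pow_separator k m A : A \in C -> (k * w A <= adeg A m)%N ->
  ideal_pow I k (X_ (mnm_muln (separator A) k +m m)).
Proof.
move=> CA; elim: k m => [|k IH] m // km.
have [m1 [m2 [-> wm1 km2]]] := adeg_split km.
rewrite /ideal_pow iterS -/(ideal_pow _ k).
have -> : mnm_muln (separator A) k.+1 +m (m1 +m m2) =
  (separator A +m m1) +m (mnm_muln (separator A) k +m m2).
  by rewrite mulmS -!addmA; congr mnm_add; rewrite addmC -addmA; congr mnm_add; rewrite addmC.
rewrite mpolyXD; apply: ideal_mul_mem; last exact: IH.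
apply/mem_linear_power => A' A'C; rewrite mul1n adegD.
have [->|A'A] := eqVneq A' A; first by rewrite adeg_separator.
by rewrite (leq_trans (leq_separator CA A'C A'A)) ?leq_addr.
Qed.

(** Denominators outside the prime cancel because its powers are primary. Conversely the [k]-th
    power of the separator is a denominator that moves the power of the prime into [I^k]. *)
Lemma loc_contraction_pow k A : A \in C ->
  loc_contraction (ideal_pow I k) (prime_pow A 1) = prime_pow A (k * w A).
Proof.
move=> CA; apply/seteqP; split=> f.
  move=> [a [s [Ia sA /eqP]]].
  have s0 : s != 0.
    by apply/eqP => s0; apply: sA; rewrite s0; exact: mem0_prime_pow.
  rewrite -[_ == _](inj_eq (mulIf (_ : tofrac s != 0))) ?tofrac_eq0 //.
  rewrite divfK ?tofrac_eq0 // -tofracM tofrac_eq => /eqP fs.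
  apply: (prime_pow_primary sA); rewrite mulrC fs.
  exact: ideal_pow_linear_power.
move=> fA; pose s := mpolyX K (mnm_muln (separator A) k).
have s0 : tofrac s != 0.
  by rewrite tofrac_eq0 -msupp_eq0 msuppX.
exists (s * f), s; split.
- have idJ : is_ideal setT [set g | ideal_pow I k (s * g)].
    have idk := ideal_pow_ideal I k; split=> //=.
    + by rewrite mulr0; exact: (ideal0 idk).
    + by move=> a b /= ha hb; rewrite mulrDr; exact: (idealD idk).
    + by move=> a b _ /= hb; rewrite mulrCA; apply: (idealM idk).
  apply: (mem_ideal_monomials idJ) => m /fA km /=.
  by rewrite -mpolyXD; exact: ideal_pow_separator.
- by move=> /prime_powX; rewrite adegMn adeg_separator.
- by rewrite tofracM mulrAC divff // mul1r.
Qed.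

Lemma loc_contraction_linear_power A : A \in C ->
  loc_contraction I (prime_pow A 1) = prime_pow A (w A).
Proof.
move=> CA; rewrite -{1}(ideal_pow1 linear_power_ideal) loc_contraction_pow //.
by rewrite mul1n.
Qed.

Lemma ass_linear_power A : A \in C -> ass_primes I (prime_pow A 1).
Proof.
move=> CA; split; first exact: prime_pow_prime.
(* [x^y] lies just outside the component at [A] and is pushed into it by any variable of [A]. For
   empty [A] the prime is zero and [y = 0] works vacuously. *)
have [y [yw yA]] : exists y : multinom n, (adeg A y < w A)%N /\
    forall m, (0 < adeg A m)%N -> (w A <= adeg A (m +m y))%N.
  have [A0|[i iA]] := set_0Vmem A.
    exists mnm0; split; first by rewrite adeg0 w_gt0.
    by move=> m; rewrite /adeg A0 big_set0.
  exists (mnm_muln (mnm1 i) (w A).-1); rewrite adegMn adeg1 iA mul1n.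
  split=> [|m m0]; first by rewrite prednK // w_gt0.
  by rewrite adegD adegMn adeg1 iA mul1n -[leqLHS]prednK ?w_gt0 // -add1n leq_add2r.
exists (X_ (separator A +m y)); apply/seteqP; split=> [f fA /=|f /=]; last first.
  rewrite IE => /(_ _ CA) fA; apply: contrapT => f1.
  have := prime_pow_primary f1 fA => /prime_powX.
  by rewrite adegD adeg_separator add0n leqNgt yw.
rewrite mulrC IE => A' A'C.
have [->|A'A] := eqVneq A' A; last first.
  rewrite mulrC; apply: prime_powMl; apply/prime_powX.
  by rewrite adegD (leq_trans (leq_separator CA A'C A'A)) ?leq_addr.
rewrite mpolyXD -mulrA; apply: prime_powMl.
have := @supportedM _ _ (fun m => m = y) (fun m => (1 <= adeg A m)%N)
  (fun m => (w A <= adeg A m)%N) (X_ y) f; apply => //.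
  by move=> m m' -> /yA; rewrite addmC.
by apply/supportedX.
Qed.

(** Write [P] as the colon ideal [(I : x)]. If each component had a multiplier outside [P] that
    sends [x] into it, the product of these would lie in [P]. So [P] contains the colon ideal of one
    component, and primariness identifies [P] with the radical of that component. *)
Lemma ass_linear_powerP P : ass_primes I P ->
  exists2 A, A \in C & P = prime_pow A 1.
Proof.
move=> [Pprime [x PE]].
have [A CA AP] : exists2 A, A \in C &
    [set a | prime_pow A (w A) (a * x)] `<=` P.
  apply: contrapT => noA.
  have h A : A \in C -> {a | prime_pow A (w A) (a * x) & ~ P a}.
    move=> CA; apply: cid2; apply: contrapT => noa; apply: noA; exists A => // a /= ax.
    by apply: contrapT => Pa; apply: noa; exists a.
  (* The value 1 is a dummy: the product runs over [A] in [C] only. *)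
  pose a A := if pselect (A \in C) is left CA then s2val (h A CA) else 1.
  apply: (@prime_ideal_prod _ P _ (mem C) a Pprime).
    by move=> A CA; rewrite /a; case: pselect => // CA'; exact: (s2valP' (h A CA')).
  rewrite PE /= IE => A CA; rewrite (bigD1 (A : {set 'I_n})) //= mulrAC mulrC.
  apply: prime_powMl.
  by rewrite /a; case: pselect => // CA'; exact: (s2valP (h A CA')).
exists A => //; apply/seteqP; split=> a.
  rewrite PE IE /= => /(_ _ CA) ax; apply: contrapT => aA.
  case: Pprime => _ P1 _; apply: P1; apply: AP; rewrite /= mul1r.
  exact: prime_pow_primary ax.
move=> aA; apply: (prime_ideal_exp Pprime (k := w A)); apply: AP => /=.
by rewrite mulrC; apply: prime_powMl; exact: prime_pow_exp.
Qed.

Lemma max_ass_linear_power A : A \in C -> max_ass_primes I (prime_pow A 1).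
Proof.
move=> CA; split; first exact: ass_linear_power.
move=> _ /ass_linear_powerP[A' A'C ->] /prime_pow_sub AA'.
by rewrite (C_antichain CA A'C AA').
Qed.

Lemma symb_powE k : symb_pow I k = supported (symb_mon k).
Proof.
apply/seteqP; split=> f.
  move=> fI m mf A CA; have := fI _ (ass_linear_power CA).
  by rewrite loc_contraction_pow //; apply.
move=> fk _ /ass_linear_powerP[A CA ->].
by rewrite loc_contraction_pow // => m /fk; apply.
Qed.

End LinearPower.

(** Minimal primes are replaced by the finite family of variable sets generating them; minimality
    makes it an antichain. *)
Lemma linear_power_typeP (K : fieldType) n (I : set {mpoly K[n]}) :
  linear_power_type I -> exists (C : {set {set 'I_n}}) w,
  [/\ forall A A', A \in C -> A' \in C -> A \subset A' -> A = A',
      forall A, A \in C -> (0 < w A)%N &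
      I = \bigcap_(A in [set` C]) prime_pow A (w A)].
Proof.
move=> [Imon [w [w_gt0 IE]]].
pose C := [set A | `[< min_primes I (@prime_pow K n A 1) >]]%SET.
exists C, (fun A => w (prime_pow A 1)).
have CP A : A \in C -> min_primes I (@prime_pow K n A 1) by rewrite inE => /asboolP.
split.
- move=> A A' /CP[Ap IA _] /CP[_ _ A'min] AA'; apply: (@prime_pow_inj K n).
  by apply: A'min => // f fA m /fA /leq_trans; apply; exact: leq_adegS.
- by move=> A /CP/w_gt0.
rewrite IE; apply/seteqP; split=> f fI.
  by move=> A /CP/fI; rewrite prime_pow_expE.
move=> P Pmin; have [A PE] := Imon _ Pmin.
rewrite monomial_primeE in PE; rewrite PE prime_pow_expE; apply: fI.
by rewrite /= inE; apply/asboolP; rewrite -PE.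
Qed.

(** * Monomial subalgebras of the Rees algebra and their face primes *)

Section SemigroupRees.
Context (K : fieldType) (n : nat) (S : nat -> multinom n -> Prop).
Context (S0 : forall m, S 0 m).
Context (SD : forall k k' m m', S k m -> S k' m' -> S (k + k') (m +m m')).
Implicit Types (p q : {poly {mpoly K[n]}}) (m : multinom n) (k : nat).

Definition rees : set {poly {mpoly K[n]}} :=
  [set p | forall k, supported (S k) p`_k].

Lemma reesX k m : S k m -> rees (X_ m *: 'X^k).
Proof.
move=> Skm k'; rewrite coefZ coefXn; have [->|_] := eqVneq k' k.
  by rewrite mulr1; apply/supportedX.
by rewrite mulr0; exact: supported0.
Qed.

Lemma reesC f : rees f%:P.
Proof.
by move=> [|k]; rewrite coefC //=; exact: supported0.
Qed.

Lemma reesD p q : rees p -> rees q -> rees (p + q).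
Proof. by move=> hp hq k; rewrite coefD; exact: supportedD. Qed.

Lemma reesM p q : rees p -> rees q -> rees (p * q).
Proof.
move=> hp hq k; rewrite coefM; apply: supported_sum => i _.
apply: supportedM (hp i) (hq (k - i)%N) => m m' hm hm'.
by rewrite -(subnKC (ltn_ord i : (i <= k)%N)); exact: SD.
Qed.

Lemma rees_subalg : GRing.subalg_closed (mem rees).
Proof.
split; first by rewrite inE -[1]/(1%:P); exact: reesC.
  move=> a u v; rewrite !inE -mul_polyC => hu hv.
  by apply: reesD => //; apply: reesM => //; exact: reesC.
by move=> u v; rewrite !inE; exact: reesM.
Qed.

Lemma subalg_gen_subalg (Y : set {poly {mpoly K[n]}}) :
  GRing.subalg_closed (mem (subalg_gen Y)).
Proof.
split.
- by rewrite inE => A [[+ _ _] _]; rewrite inE.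
- move=> a u v; rewrite !inE => hu hv A hA; have [[_ hL _] _] := hA.
  by have := hL a u v; rewrite !inE; apply; [exact: hu|exact: hv].
- move=> u v; rewrite !inE => hu hv A hA; have [[_ _ hM] _] := hA.
  by have := hM u v; rewrite !inE; apply; [exact: hu|exact: hv].
Qed.

(** Induction on [k + mdeg m]: above degree [d] a monomial loses a variable, which is a scalar from
    the base ring, or splits into two factors of smaller positive degree in [t]. *)
Lemma rees_generated d :
  (forall k m, S k m -> (d < k)%N ->
     (exists i m', m = mnm1 i +m m' /\ S k m') \/
     exists k1 k2 m1 m2, [/\ (0 < k1)%N, (0 < k2)%N, k = (k1 + k2)%N,
       m = m1 +m m2 & S k1 m1 /\ S k2 m2]) ->
  rees = subalg_gen [set p | exists k a,
      [/\ (1 <= k <= d)%N, supported (S k) a & p = a *: 'X^k]].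
Proof.
move=> dec; apply/seteqP; split; last first.
  apply: smallest_sub; first exact: rees_subalg.
  move=> _ [k [a [_ ha ->]]] k'; rewrite coefZ coefXn.
  by have [->|_] := eqVneq k' k; rewrite (mulr1, mulr0) //; exact: supported0.
set Y := [set p | _]; have [] := subalg_gen_subalg Y.
have YG : Y `<=` subalg_gen Y by exact: sub_gen_smallest.
move: (subalg_gen Y) YG => G YG; rewrite inE => G1 GL GM.
have GZ a u : G u -> G (a *: u).
  move=> Gu; have G0 : G 0 by have := GL (-1) 1 1; rewrite !inE scaleN1r addNr; apply.
  by have := GL a u 0; rewrite !inE addr0; apply.
have GD u v : G u -> G v -> G (u + v).
  by move=> Gu Gv; have := GL 1 u v; rewrite !inE scale1r; apply.
have G0 : G 0 by rewrite -(scale0r 1); exact: GZ.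
have Gsum (T : Type) (r : seq T) (P : pred T) h :
    (forall i, P i -> G (h i)) -> G (\sum_(i <- r | P i) h i).
  by move=> Gh; elim/big_rec: _ => // i x Pi Gx; apply: GD => //; exact: Gh.
have GX : forall k m, S k m -> G (X_ m *: 'X^k).
  move=> k m; have [N] := ubnP (k + mdeg m)%N; elim: N k m => // N IH k m lt_N Skm.
  have [kd|dk] := leqP k d.
    case: k kd lt_N Skm => [|k] kd lt_N Skm; first by rewrite expr0; apply: GZ; exact: G1.
    by apply: YG; exists k.+1, (X_ m); split=> //; apply/supportedX.
  case: (dec _ _ Skm dk) => [[i [m' [mE Skm']]]|].
    rewrite mE mpolyXD -scalerA; apply: GZ; apply: IH => //.
    by move: lt_N; rewrite mE mdegD mdeg1 add1n addnS ltnS.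
  move=> [k1 [k2 [m1 [m2 [k1_gt0 k2_gt0 kE mE [S1 S2]]]]]].
  move: lt_N; rewrite kE mE mdegD ltnS => lt_N.
  have -> : X_ (m1 +m m2) *: 'X^(k1 + k2) = (X_ m1 *: 'X^k1) * (X_ m2 *: 'X^k2)
      :> {poly {mpoly K[n]}}.
    by rewrite -scalerAl -scalerAr scalerA mpolyXD exprD.
  have := GM (X_ m1 *: 'X^k1) (X_ m2 *: 'X^k2); rewrite !inE.
  apply; apply: IH => //; apply: leq_trans lt_N.
    by rewrite addnACA -[ltnLHS]addn0 -addnS leq_add // ltn_addr.
  by rewrite addnACA -[ltnLHS]add0n -addSn leq_add // ltn_addr.
move=> p hp; rewrite -[p]coefK poly_def; apply: (Gsum) => k _.
rewrite [p`_k]mpolyE scaler_suml big_seq; apply: Gsum => m /hp hm.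
by rewrite -mul_mpolyC -scalerA; apply: GZ; exact: GX.
Qed.

Section Face.
Context (F : nat -> pred (multinom n)).
Context (F0 : F 0 mnm0).
Context (FD : forall k k' m m', S k m -> S k' m' ->
  F (k + k')%N (m +m m') = F k m && F k' m').

(** By [FD] the exponents in [F] form a face of the semigroup [S]; this is the span of the monomials
    off that face. *)
Definition face_prime : set {poly {mpoly K[n]}} :=
  [set p | rees p /\ forall k, supported (fun m => ~~ F k m) p`_k].

Definition pproj p : {poly {mpoly K[n]}} := \poly_(k < size p) mproj (F k) p`_k.

Lemma coef_pproj p k : (pproj p)`_k = mproj (F k) p`_k.
Proof.
rewrite coef_poly; case: ltnP => // pk.
by rewrite nth_default // raddf0.
Qed.

Lemma pprojM p q : rees p -> rees q -> pproj (p * q) = pproj p * pproj q.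
Proof.
move=> hp hq; apply/polyP => k; rewrite coef_pproj !coefM raddf_sum /=.
apply: eq_bigr => i _; rewrite !coef_pproj; apply: mproj_mul => m m' hm hm'.
rewrite -FD ?subnKC //; [exact: (ltn_ord i : (i <= k)%N)| exact: hp| exact: hq].
Qed.

Lemma face_primeE p : rees p -> face_prime p <-> pproj p = 0.
Proof.
move=> hp; split=> [[_ pF]|p0].
  by apply/polyP => k; rewrite coef_pproj coef0; apply/mproj_eq0.
by split=> // k; apply/mproj_eq0; rewrite -coef_pproj p0 coef0.
Qed.

(** On [rees] the projection [pproj] to the face is multiplicative with values in a domain, and the
    face prime is its kernel. *)
Lemma face_prime_prime : is_prime_ideal rees face_prime.
Proof.
split.
- split.
  + by move=> p [].
  + by split=> k; rewrite coef0; exact: supported0.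
  + by move=> p q [hp Fp] [hq Fq]; split; [exact: reesD|move=> k; rewrite coefD; exact: supportedD].
  + move=> p q hp [hq Fq]; apply/(face_primeE (reesM hp hq)).
    by rewrite pprojM // (iffLR (face_primeE hq)) ?mulr0.
- move=> [_ /(_ 0%N mnm0)]; rewrite coef1 eqxx mulr1n -mpolyX0 msuppX inE eqxx F0.
  by move=> /(_ isT).
- move=> p q hp hq /(face_primeE (reesM hp hq))/eqP.
  rewrite pprojM // mulf_eq0 => /orP[]/eqP; [left|right]; exact/face_primeE.
Qed.

Lemma face_primeX k m : S k m -> face_prime (X_ m *: 'X^k) <-> ~~ F k m.
Proof.
move=> Skm; split=> [[_ /(_ k)]|Fm].
  by rewrite coefZ coefXn eqxx mulr1 => /supportedX.
split=> [|k']; first exact: reesX.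
rewrite coefZ coefXn; have [->|_] := eqVneq k' k.
  by rewrite mulr1; apply/supportedX.
by rewrite mulr0; exact: supported0.
Qed.

Lemma max_graded_ideal_sub_face : (forall i, ~~ F 0 (mnm1 i)) ->
  ideal_gen rees [set f%:P | f in @max_graded_ideal K n] `<=` face_prime.
Proof.
move=> FX; have [idF _ _] := face_prime_prime.
apply: smallest_sub => // _ [f fm <-].
have: f \in [set g | face_prime g%:P]; last by rewrite inE.
rewrite inE; move: f fm; apply: smallest_sub.
  split; first by move=> ? _.
  - exact: (ideal0 idF).
  - by move=> a b /= ha hb; rewrite polyCD; exact: (idealD idF).
  - move=> a b _ /= hb; rewrite polyCM; apply: (idealM idF); last exact: hb.
    exact: reesC.
move=> _ [i _ <-] /=; rewrite -alg_polyC.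
have /(_ (S0 _)) := @face_primeX 0 (mnm1 i); rewrite expr0 => h.
by apply/h; exact: FX.
Qed.

End Face.

End SemigroupRees.

(** * The symbolic polyhedron *)

Section Newton.
Context (R : realType) (K : fieldType) (n : nat).
Implicit Types (A : {set 'I_n}) (m : multinom n) (w : nat) (u : 'rV[R]_n).

Lemma newton_prime_pow_le A w u :
  newton_polyhedron R (@prime_pow K n A w) u -> w%:R <= \sum_(i in A) u 0 i.
Proof.
move=> hu; have: u \in [set u : 'rV[R]_n | w%:R <= \sum_(i in A) u 0 i]; last by rewrite inE.
rewrite inE; move: u hu; apply: smallest_sub; last first.
  move=> _ [m /prime_powX wm <-] /=.
  rewrite (eq_bigr (fun i => (m i)%:R)) => [|i _]; last by rewrite mxE.
  by rewrite -natr_sum ler_nat.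
move=> x y t; rewrite !inE /= => hx hy.
rewrite (eq_bigr (fun i => t%:num * x 0 i + (1 - t%:num) * y 0 i)); last first.
  by move=> i _; rewrite !mxE.
rewrite big_split -!mulr_sumr /=.
have : t%:num * w%:R <= t%:num * \sum_(i in A) x 0 i by rewrite ler_wpM2l.
have : (1 - t%:num) * w%:R <= (1 - t%:num) * \sum_(i in A) y 0 i.
  by rewrite ler_wpM2l // subr_ge0.
by lra.
Qed.

(** Split [x^m] into [N.+1] monomials of the ideal: the point is their average. In the induction the
    first one gets weight [1/(N+2)] and the average of the others the remaining weight. *)
Lemma newton_prime_pow_lattice A w N m : (N.+1 * w <= adeg A m)%N ->
  newton_polyhedron R (@prime_pow K n A w) (N.+1%:R^-1 *: \row_j (m j)%:R).
Proof.
move=> hm Q [Qconv Qmem]; elim: N m hm => [|N IH] m hm.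
  by rewrite invr1 scale1r; apply: Qmem; exists m => //; apply/prime_powX; rewrite -[w]mul1n.
have [m1 [m2 [-> hm1 /IH Q2]]] := adeg_split hm.
have Q1 : Q (\row_j (m1 j)%:R).
  by apply: Qmem; exists m1 => //; apply/prime_powX.
pose t : R := N.+2%:R^-1.
have t0 : 0 <= t by rewrite invr_ge0.
have t1 : t <= 1 by rewrite invf_le1 ?ltr0n // ler1n.
have := Qconv _ _ (Itv01 t0 t1) (mem_set Q1) (mem_set Q2).
rewrite inE; congr (Q _); apply/rowP => j; rewrite !mxE /= mnmDE natrD.
rewrite /unstable.onem /t; set a := (m1 j)%:R; set b := (m2 j)%:R.
have : N.+1%:R != 0 :> R by rewrite pnatr_eq0.
rewrite -[N.+2%:R]natr1; set c : R := N.+1%:R => c0.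
have c1 : c + 1 != 0 by rewrite natr1 pnatr_eq0.
clearbody a b c.
by field; rewrite c0 c1.
Qed.

End Newton.

(** * The cone over the symbolic polyhedron *)

Section SymbCone.
Context (n : nat) (C : {set {set 'I_n}}) (w : {set 'I_n} -> nat).
Local Notation J := (option ('I_n + {set 'I_n})).

(* The cone over the symbolic polyhedron, cut out by [h >= 0], [u_j >= 0] and
   [sum_(j in A) u_j >= h w_A]. The trivial constraints for [A \notin C] keep
   the index type simple. *)
Definition con_h (F : realFieldType) (t : J) : F :=
  match t with
  | None => 1
  | Some (inl _) => 0
  | Some (inr A) => if A \in C then - (w A)%:R else 0
  end.

Definition con_u (F : realFieldType) (t : J) (j : 'I_n) : F :=
  match t with
  | None => 0
  | Some (inl i) => (j == i)%:R
  | Some (inr A) => if A \in C then (j \in A)%:R else 0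
  end.

Definition con (F : realFieldType) (t : J) : 'cV[F]_(1 + n) :=
  col_mx (con_h F t)%:M (\col_j con_u F t j).

Section Field.
Context (F : realFieldType).
Implicit Types (h : F) (u : 'rV[F]_n) (z : 'rV[F]_(1 + n)) (t : J).

Definition pt h u : 'rV[F]_(1 + n) := row_mx h%:M u.

Lemma ptP z : exists h u, z = pt h u.
Proof.
by exists (lsubmx z 0 0), (rsubmx z); rewrite /pt -mx11_scalar hsubmxK.
Qed.

Lemma pairing_pt t h u :
  pairing (con F) t (pt h u) = h * con_h F t + \sum_j u 0 j * con_u F t j.
Proof.
rewrite /pairing /con /pt mul_row_col -scalar_mxM !mxE mulr1n; congr (_ + _).
by apply: eq_bigr => j _; rewrite mxE.
Qed.

Lemma pairing_height h u : pairing (con F) None (pt h u) = h.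
Proof. by rewrite pairing_pt mulr1 big1 ?addr0 // => j _; rewrite mulr0. Qed.

Lemma pairing_coord h u j : pairing (con F) (Some (inl j)) (pt h u) = u 0 j.
Proof.
rewrite pairing_pt mulr0 add0r (bigD1 j) //= eqxx mulr1 big1 ?addr0 // => i.
by move=> /negPf ->; rewrite mulr0.
Qed.

Lemma pairing_set h u A : pairing (con F) (Some (inr A)) (pt h u) =
  if A \in C then \sum_(j in A) u 0 j - h * (w A)%:R else 0.
Proof.
rewrite pairing_pt /=; case: ifP => CA; last first.
  by rewrite mulr0 add0r big1 // => j _; rewrite mulr0.
rewrite mulrN addrC; congr (_ - _); rewrite [RHS]big_mkcond.
by apply: eq_bigr => j _; case: ifP; rewrite (mulr1, mulr0).
Qed.

Lemma con_u_ge0 t j : 0 <= con_u F t j.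
Proof. by case: t => [[i|A]|] //=; case: ifP. Qed.

Definition lat k (m : multinom n) : 'rV[F]_(1 + n) :=
  pt k%:R (\row_j (m j)%:R).

Lemma latD k k' m m' : lat (k + k') (m +m m') = lat k m + lat k' m'.
Proof.
rewrite /lat /pt add_row_mx natrD raddfD; congr row_mx.
by apply/rowP => j; rewrite !mxE mnmDE natrD.
Qed.

Lemma pairing_lat_set k m A : A \in C ->
  pairing (con F) (Some (inr A)) (lat k m) = (adeg A m)%:R - (k * w A)%:R.
Proof.
move=> CA; rewrite pairing_set CA natrM natr_sum; congr (_ - _).
by apply: eq_bigr => j _; rewrite mxE.
Qed.

Lemma in_cone_lat k m : in_cone (con F) (lat k m) <-> symb_mon C w k m.
Proof.
split=> [h A CA|h [[j|A]|]].
- by have := h (Some (inr A)); rewrite pairing_lat_set // subr_ge0 ler_nat.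
- by rewrite pairing_coord mxE.
- have [CA|CA] := boolP (A \in C); last by rewrite pairing_set (negPf CA).
  by rewrite pairing_lat_set // subr_ge0 ler_nat; exact: h.
- by rewrite pairing_height.
Qed.

Lemma pairing_var j t : pairing (con F) t (lat 0 (mnm1 j)) = con_u F t j.
Proof.
rewrite pairing_pt mul0r add0r (bigD1 j) //= mxE mnm1E eqxx mul1r big1 ?addr0 //.
by move=> i /negPf ij; rewrite mxE mnm1E eq_sym ij mul0r.
Qed.

(** At height 0 a point of the cone has nonnegative coordinates, and each of them occurs with
    positive coefficient in a constraint of [T] that vanishes, so each is 0. *)
Lemma con_pointed (T : {set J}) :
  (forall j, exists2 t, t \in T & con_u F t j != 0) ->
  forall z, (forall t, t \in T -> pairing (con F) t z = 0) ->
    pairing (con F) None z = 0 -> in_cone (con F) z -> z = 0.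
Proof.
move=> Tpos z; have [h [u ->]] := ptP z => zT; rewrite pairing_height => h0 zcone.
have u_ge0 j : 0 <= u 0 j by have := zcone (Some (inl j)); rewrite pairing_coord.
rewrite /pt h0 raddf0 (_ : u = 0) ?row_mx0 //; apply/rowP => j; rewrite mxE.
have [t tT tj] := Tpos j; have /eqP := zT _ tT.
rewrite pairing_pt h0 mul0r add0r psumr_eq0 => [/allP/(_ j)|i _]; last first.
  by rewrite mulr_ge0 ?con_u_ge0.
by rewrite mem_index_enum mulf_eq0 (negPf tj) orbF => /(_ isT)/eqP.
Qed.

(* If no variable divides [x^m t^k] in the symbolic Rees algebra then [(m, k)]
   lies on a compact face: every coordinate direction leaves it. *)
Lemma tight_pos k m : symb_mon C w k m ->
  (forall i m', m = mnm1 i +m m' -> ~ symb_mon C w k m') ->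
  forall j, exists2 t, t \in tight (con F) (lat k m) & con_u F t j != 0.
Proof.
move=> Smk irr j; have [mj|mj] := posnP (m j).
  exists (Some (inl j)); last by rewrite /= eqxx oner_eq0.
  by rewrite mem_tight pairing_coord mxE mj.
have mE : m = mnm1 j +m mnm_sub m (mnm1 j) by rewrite addmC submK // lep1mP -lt0n.
have /existsNP[A /not_implyP[CA /negP]] := irr _ _ mE.
rewrite -ltnNge => lt_m'; have aE := adegD A (mnm1 j) (mnm_sub m (mnm1 j)).
rewrite -mE adeg1 in aE; have := Smk A CA; rewrite aE.
case jA: (j \in A) aE => aE; last by rewrite add0n leqNgt lt_m'.
rewrite (add1n (adeg _ _)) => le_m'.
exists (Some (inr A)); last by rewrite /= CA jA oner_eq0.
rewrite mem_tight pairing_lat_set // subr_eq0 eqr_nat aE add1n.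
by rewrite eqn_leq lt_m' le_m'.
Qed.

End Field.
End SymbCone.

(** * Clearing denominators of rational points *)

Section Denominators.
Context (R : realType) (n : nat).

Lemma denominator_ratr (q : rat) : denominator (ratr q : R) = `|denq q|%N.
Proof.
apply: xget_unique; first by exists q.
by move=> _ [q' /= /fmorph_inj -> <-].
Qed.

Lemma lcm_denominators_gt0 (u : 'rV[R]_n) : (0 < lcm_denominators u)%N.
Proof.
rewrite /lcm_denominators; elim/big_rec: _ => // j d _ d_gt0.
rewrite lcmn_gt0 d_gt0 andbT /denominator; case: xgetP => // _ _ [q _ <-].
by rewrite absz_gt0 denq_eq0.
Qed.

Lemma lcm_denominators_clear (u : 'rV[rat]_n) : (forall j, 0 <= u 0 j) ->
  exists m : multinom n, forall j,
    (lcm_denominators (map_mx ratr u : 'rV[R]_n))%:R * u 0 j = (m j)%:R.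
Proof.
set d := lcm_denominators _ => u_ge0.
exists (mnm_of (fun j => (d %/ `|denq (u 0%R j)|) * `|numq (u 0%R j)|)%N) => j.
rewrite mnm_ofE natrM.
have dj : (`|denq (u 0%R j)| %| d)%N.
  rewrite /d /lcm_denominators (bigD1 j) //= mxE denominator_ratr.
  exact: dvdn_lcml.
rewrite -[in LHS](divnK dj) natrM -mulrA; congr (_ * _).
have -> : `|numq (u 0%R j)|%N%:R = (numq (u 0 j))%:~R :> rat.
  by rewrite -[in RHS](gez0_abs (_ : 0 <= numq (u 0 j))) ?numq_ge0.
have -> : `|denq (u 0%R j)|%N%:R = (denq (u 0 j))%:~R :> rat.
  by rewrite -[in RHS](gez0_abs (_ : 0 <= denq (u 0 j))).
by rewrite -{2}[u 0 j]divq_num_den mulrC divfK // intr_eq0 denq_eq0.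
Qed.

End Denominators.

(** * Vertices of the symbolic polyhedron *)

Section Vertices.
Context (R : realType) (K : fieldType) (n : nat) (I : set {mpoly K[n]}).
Context (C : {set {set 'I_n}}) (w : {set 'I_n} -> nat).
Context (C_antichain : forall A A', A \in C -> A' \in C -> A \subset A' -> A = A').
Context (w_gt0 : forall A, A \in C -> (0 < w A)%N).
Context (IE : I = \bigcap_(A in [set` C]) prime_pow A (w A)).

Lemma con_map t : con C w R t = map_mx ratr (con C w rat t).
Proof.
rewrite /con map_col_mx map_scalar_mx; congr col_mx.
  congr (_%:M); case: t => [[i|A]|] /=; rewrite ?rmorph0 ?rmorph1 //.
  by case: ifP; rewrite ?rmorph0 // rmorphN rmorph_nat.
apply/colP => j; rewrite !mxE; case: t => [[i|A]|] /=; rewrite ?rmorph0 ?rmorph_nat //.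
by case: ifP; rewrite ?rmorph0 // rmorph_nat.
Qed.

Lemma pairing_map t z :
  pairing (con C w R) t (map_mx ratr z) = ratr (pairing (con C w rat) t z).
Proof. by rewrite /pairing con_map -map_mxM mxE. Qed.

Lemma symb_polyhedron_cone x :
  symb_polyhedron R I x -> in_cone (con C w R) (pt 1 x).
Proof.
move=> [x_ge0 xI] [[j|A]|]; rewrite ?pairing_coord ?pairing_height //.
rewrite pairing_set; case: ifP => // CA; rewrite mul1r subr_ge0.
have := xI _ (max_ass_linear_power C_antichain w_gt0 IE CA).
rewrite (loc_contraction_linear_power C_antichain IE CA).
exact: newton_prime_pow_le.
Qed.

(** A rational point is a lattice point divided by a common denominator, so
    [newton_prime_pow_lattice] places it in each Newton polyhedron. *)
Lemma cone_symb_polyhedron (u : 'rV[rat]_n) :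
  in_cone (con C w rat) (pt 1 u) -> symb_polyhedron R I (map_mx ratr u).
Proof.
move=> ucone.
have u_ge0 j : 0 <= u 0 j by have := ucone (Some (inl j)); rewrite pairing_coord.
split=> [j|P [/(ass_linear_powerP IE)[A CA ->] _]]; first by rewrite mxE ler0q.
rewrite (loc_contraction_linear_power C_antichain IE CA).
have [m mE] := lcm_denominators_clear R u_ge0.
move: mE (lcm_denominators_gt0 (map_mx ratr u : 'rV[R]_n)).
case: (lcm_denominators _) => // d mE _.
have -> : map_mx ratr u = d.+1%:R^-1 *: \row_j (m j)%:R :> 'rV[R]_n.
  apply/rowP => j; rewrite !mxE; apply/(canRL (mulKf _)); rewrite ?pnatr_eq0 //.
  by rewrite -[d.+1%:R](ratr_nat R) -rmorphM /= mE ratr_nat.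
apply: newton_prime_pow_lattice.
have := ucone (Some (inr A)); rewrite pairing_set CA mul1r subr_ge0.
rewrite -(ler_pM2l (_ : 0 < d.+1%:R)) ?ltr0n // mulr_sumr -natrM.
by rewrite (eq_bigr (fun j => (m j)%:R)) // -natr_sum ler_nat.
Qed.

(** The sum of the constraints tight at [u] is the supporting functional. Where it attains its
    bound, each of these constraints vanishes, and [uker] leaves [u] alone. *)
Lemma extreme_vertex (u : 'rV[rat]_n) :
  in_cone (con C w rat) (pt 1 u) ->
  (forall z, (forall t, t \in tight (con C w rat) (pt 1 u) ->
     pairing (con C w rat) t z = 0) -> pairing (con C w rat) None z = 0 ->
     z = 0) ->
  vertices (symb_polyhedron R I) (map_mx ratr u).
Proof.
move=> ucone; set T := tight _ _ => uker.
(* Adjoining the height to [T] turns [uker] into injectivity of a rational linear map, which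
   persists over [R]. *)
have ker (z : 'rV[R]_(1 + n)) : (forall t, t \in T -> pairing (con C w R) t z = 0) ->
    pairing (con C w R) None z = 0 -> z = 0.
  move=> zT z0; apply: (pairing_map_ker (f := ratr) (N := con C w rat) (T := None |: T)).
    move=> y yT; apply: uker; last by apply: yT; rewrite setU11.
    by move=> t tT; apply: yT; rewrite setU1r.
  move=> t; rewrite finset.in_setU1 /pairing -con_map => /orP[/eqP ->|/zT] //.
have TE (x : 'rV[R]_n) : \sum_j (\row_j \sum_(t in T) con_u C R t j) 0 j * x 0 j =
    \sum_(t in T) pairing (con C w R) t (pt 1 x) - \sum_(t in T) con_h C w R t.
  rewrite -sumrB [RHS](eq_bigr (fun t => \sum_j x 0 j * con_u C R t j)).
    rewrite exchange_big; apply: eq_bigr => j _.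
    by rewrite mxE mulr_suml; apply: eq_bigr => t _; rewrite mulrC.
  by move=> t _; rewrite pairing_pt mul1r addrAC subrr add0r.
exists (\row_j \sum_(t in T) con_u C R t j), (- \sum_(t in T) con_h C w R t).
split=> [x /symb_polyhedron_cone xcone|].
  by rewrite TE lerDr; apply: sumr_ge0 => t _; exact: xcone.
have ptu : pt 1 (map_mx ratr u) = map_mx ratr (pt 1 u) :> 'rV[R]_(1 + n).
  by rewrite /pt map_row_mx map_scalar_mx; congr (row_mx _%:M _); rewrite rmorph1.
apply/seteqP; split=> [x [/symb_polyhedron_cone xcone]|_ ->] /=; last first.
  split; first exact: cone_symb_polyhedron.
  rewrite TE big1 ?add0r // => t tT.
  by rewrite ptu pairing_map (tightP tT) rmorph0.
rewrite TE => /eqP; rewrite -subr_eq0 opprK addrNK psumr_eq0 => [/allP xT|t _]; last exact: xcone.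
have : pt 1 x - pt 1 (map_mx ratr u) = 0.
  apply: ker => [t tT|]; rewrite pairingD pairingN; last first.
    by rewrite !pairing_height subrr.
  have /implyP/(_ tT)/eqP -> := xT t (mem_index_enum _).
  by rewrite ptu pairing_map (tightP tT) rmorph0 subrr.
by move=> /eqP; rewrite subr_eq0 => /eqP/eq_row_mx[].
Qed.

End Vertices.

(** * Generators of the symbolic Rees algebra *)

Section Generation.
Context (R : realType) (K : fieldType) (n : nat) (I : set {mpoly K[n]}).
Context (C : {set {set 'I_n}}) (w : {set 'I_n} -> nat).
Context (C_antichain : forall A A', A \in C -> A' \in C -> A \subset A' -> A = A').
Context (w_gt0 : forall A, A \in C -> (0 < w A)%N).
Context (IE : I = \bigcap_(A in [set` C]) prime_pow A (w A)).
Local Notation S := (symb_mon C w).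
Local Notation N := (con C w rat).
Local Notation J := (option ('I_n + {set 'I_n})).

Lemma symb_mon0 m : S 0 m.
Proof. by move=> A _; rewrite mul0n. Qed.

Lemma symb_reesE : symb_rees I = rees S.
Proof.
apply/seteqP; split=> p hp k; have := hp k.
  by rewrite (symb_powE C_antichain w_gt0 IE).
by rewrite -(symb_powE C_antichain w_gt0 IE).
Qed.

(** The sets [T 0], ..., [T s] cut out a strictly decreasing chain of [s + 1] faces, whose face
    primes form a chain of length [s]. The condition on [T 0] keeps the variables off every face, so
    that all these primes contain the maximal ideal. *)
Lemma symb_spread_ge s (T : nat -> {set J}) :
  (forall j, exists2 t, t \in T 0%N & con_u C rat t j != 0) ->
  (forall i, (i < s)%N -> T i \subset T i.+1 /\
     exists k m, [/\ S k m, T i \subset tight N (lat rat k m) &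
       exists2 t, t \in T i.+1 & pairing N t (lat rat k m) != 0]) ->
  (s%:R%:E <= symb_spread R I)%E.
Proof.
move=> T0 Tchain.
pose F i k m := T i \subset tight N (lat rat k m).
have FT i k m : F i k m <-> forall t, t \in T i -> pairing N t (lat rat k m) = 0.
  split=> [/fintype.subsetP h t /h|h]; first by rewrite mem_tight => /eqP.
  by apply/fintype.subsetP => t tT; rewrite mem_tight h.
have F0 i : F i 0%N mnm0.
  apply/FT => t _; rewrite /lat (_ : \row_j _ = 0) ?pairing_pt ?mul0r ?add0r.
    by rewrite big1 // => j _; rewrite mxE mul0r.
  by apply/rowP => j; rewrite !mxE mnm0E.
have FD i k k' m m' : S k m -> S k' m' ->
    F i (k + k')%N (m +m m') = F i k m && F i k' m'.
  (* Constraints are nonnegative on both summands, hence vanish on the sum only if they vanish on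
     each. *)
  move=> /(in_cone_lat C w rat) hkm /(in_cone_lat C w rat) hkm'.
  apply/idP/andP => [/FT h|[/FT h /FT h']]; last first.
    by apply/FT => t tT; rewrite latD pairingD h // h' // addr0.
  by split; apply/FT => t tT; have /eqP := h t tT;
    rewrite latD pairingD paddr_eq0 ?hkm ?hkm' // => /andP[/eqP e /eqP e'].
have Fprime i : is_prime_ideal (rees S) (face_prime (K := K) S (F i)).
  exact: (face_prime_prime K (@symb_monD _ C w) (F0 i) (FD i)).
have Tsub i : (i <= s)%N -> T 0%N \subset T i.
  elim: i => // i IH is_; apply: fintype.subset_trans (IH (ltnW is_)) _.
  by have [] := Tchain i is_.
apply: ereal_sup_ubound; exists s => //.
exists (fun i => face_prime (K := K) S (F i)); rewrite symb_reesE; split=> i is_.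
  split=> //; apply: (@max_graded_ideal_sub_face K n S symb_mon0 (@symb_monD _ C w) _ (F0 i) (FD i)).
  move=> j; apply/negP => /FT h; have [t tT tj] := T0 j.
  have := h t (fintype.subsetP (Tsub i is_) _ tT).
  by rewrite pairing_var => /eqP; rewrite (negPf tj).
have [TS [k [m [Skm Tk [t tT tkm]]]]] := Tchain i is_.
split=> [p [hp hF]|].
  split=> // k' m' /hF; apply: contra; exact: fintype.subset_trans.
(* Strictness: the given monomial lies on face [i] but not on face [i.+1]. *)
move=> /(_ (mpolyX K m *: 'X^k)) h.
have /h /face_primeX : face_prime (K := K) S (F i.+1) (mpolyX K m *: 'X^k).
  by apply/face_primeX => //; apply/negP => /FT/(_ t tT)/eqP; rewrite (negPf tkm).
by move=> /(_ Skm); rewrite /F Tk.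
Qed.

(** The rays through the vertices of the symbolic polyhedron, normalised to height 1. *)
Definition extreme_ray (g : 'rV[rat]_(1 + n)) : Prop :=
  [/\ in_cone N g, pairing N None g = 1 &
    forall z, (forall t, t \in tight N g -> pairing N t z = 0) ->
      pairing N None z = 0 -> z = 0].

Context (D : nat).
Context (leD : forall v, vertices (symb_polyhedron R I) v ->
  (lcm_denominators v <= D)%N).

Lemma extreme_ray_lattice g : extreme_ray g ->
  exists d m, [/\ (0 < d <= D)%N, S d m & lat rat d m = d%:R *: g].
Proof.
have [h [u ->]] := ptP g => -[ucone]; rewrite pairing_height => h1; subst h.
move=> uker; have u_ge0 j : 0 <= u 0 j.
  by have := ucone (Some (inl j)); rewrite pairing_coord.
have [m mE] := lcm_denominators_clear R u_ge0.
have uvert := extreme_vertex R C_antichain w_gt0 IE ucone uker.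
have latE : lat rat (lcm_denominators (map_mx ratr u : 'rV[R]_n)) m =
    (lcm_denominators (map_mx ratr u : 'rV[R]_n))%:R *: pt 1 u.
  rewrite /lat /pt scale_row_mx scale_scalar_mx mulr1; congr row_mx.
  by apply/rowP => j; rewrite !mxE mE.
exists (lcm_denominators (map_mx ratr u : 'rV[R]_n)), m; split=> //.
  by rewrite lcm_denominators_gt0 leD.
by apply/(in_cone_lat C w rat); rewrite latE; apply: in_coneZ.
Qed.

Lemma symb_mon_split k m d m' :
  S d m' -> in_cone N (lat rat k m - lat rat d m') ->
  exists m2, [/\ (d <= k)%N, m = m' +m m2 & S (k - d) m2].
Proof.
move=> Sd hcone.
have dk : (d <= k)%N.
  have := hcone None; rewrite pairingD pairingN !pairing_height.
  by rewrite subr_ge0 ler_nat.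
have mm : m = m' +m mnm_sub m m'.
  rewrite addmC submK //; apply/mnm_lepP => j.
  have := hcone (Some (inl j)); rewrite pairingD pairingN !pairing_coord !mxE.
  by rewrite subr_ge0 ler_nat.
exists (mnm_sub m m'); split=> //; apply/(in_cone_lat C w rat).
by move: hcone; rewrite {1}mm -{1}(subnKC dk) latD addrC addKr.
Qed.

Lemma symb_mon_decompose k m : S k m -> (D < k)%N ->
  [\/ exists i m', m = mnm1 i +m m' /\ S k m',
      exists k1 k2 m1 m2, [/\ (0 < k1)%N, (0 < k2)%N, k = (k1 + k2)%N,
        m = m1 +m m2 & S k1 m1 /\ S k2 m2] |
      exists2 s, (s%:R%:E <= symb_spread R I)%E & (k < s * D)%N].
Proof.
move=> Skm Dk; set p := lat rat k m.
have [|irr] := pselect (exists i m', m = mnm1 i +m m' /\ S k m'); first by constructor 1.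
have Tpos := tight_pos rat Skm _.
have {Tpos} Tpos : forall j, exists2 t, t \in tight N p & con_u C rat t j != 0.
  by apply: Tpos => i m' mE Skm'; apply: irr; exists i, m'.
have pcone : in_cone N p by apply/in_cone_lat.
have [|y ycone Ty y_neq0|s [T [T_0 pE sG chain]]] :=
  @pulling _ _ _ N extreme_ray (tight N p) p _ _ pcone (fintype.subxx _).
- by move=> g [_ g1 _]; exists None; rewrite g1.
(* The face of [p] is compact, so [y] has positive height; rescaled to height 1, it has a vertex on
   its face. *)
- have h_ge0 := ycone None.
  have h_neq0 : pairing N None y != 0.
    apply: contra y_neq0 => /eqP h0; apply/eqP.
    by apply: (con_pointed Tpos) => // t /(fintype.subsetP Ty)/tightP.
  have y'T : tight N y \subset tight N ((pairing N None y)^-1 *: y).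
    by apply/fintype.subsetP => t /tightP ty; rewrite mem_tight pairingZ ty mulr0.
  have [|||g [gcone yg g1 gker]] :=
      @vertex_of_face _ _ _ N None _ ((pairing N None y)^-1 *: y) (con_pointed Tpos) _ _ _.
  + by apply: in_coneZ; rewrite ?invr_ge0.
  + exact: fintype.subset_trans y'T.
  + by rewrite pairingZ mulVf.
  by exists g; [split|exact: fintype.subset_trans yg].
(* If a coefficient reaches the denominator [d] of its vertex, the lattice point [d] times the
   vertex can be subtracted inside the cone. Both factors have positive degree because
   [d <= D < k]. *)
have [[x [d [m1 [xs /andP[d_gt0 dD] Sd latE dx]]]]|small] :=
    pselect (exists x d m1, [/\ x \in s, (0 < d <= D)%N, S d m1,
      lat rat d m1 = d%:R *: x.2 & d%:R <= x.1]).
  constructor 2; have [|m2 [dk mE Sm2]] := symb_mon_split (k := k) (m := m) Sd.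
    rewrite -/p pE latE (big_rem x) //= addrAC -scalerBl; apply: in_coneD.
      by apply: in_coneZ; rewrite ?subr_ge0 //; have [_ []] := sG _ xs.
    rewrite big_seq; elim/big_rec: _ => [t|z q /mem_rem zs qcone].
      by rewrite pairing0.
    by apply: in_coneD => //; have [z0 [zcone _ _]] := sG _ zs; apply: in_coneZ.
  exists d, (k - d)%N, m1, m2; split=> //; last by rewrite subnKC.
  by rewrite subn_gt0 (leq_ltn_trans dD).
constructor 3; exists (size s).
  apply: (@symb_spread_ge _ T); first by rewrite T_0.
  move=> i is_; have [TS Tg [t tT tg]] := chain i is_; split=> //.
  have [_ /extreme_ray_lattice[d [m' [/andP[d_gt0 _] Sd latE]]]] :=
    sG _ (mem_nth (0, 0) is_).
  exists d, m'; split=> //; rewrite ?latE.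
    apply/fintype.subsetP => t' /(fintype.subsetP Tg)/tightP t'g.
    by rewrite mem_tight pairingZ t'g mulr0.
  by exists t => //; rewrite pairingZ mulf_neq0 // pnatr_eq0 -lt0n.
(* Compare heights: every vertex has height 1. *)
have kE : k%:R = \sum_(x <- s) x.1.
  transitivity (pairing N None p); first by rewrite pairing_height.
  rewrite pE big_seq [RHS]big_seq; elim/big_ind2: _ => [|a b a' b' <- <-|x xs].
  - by rewrite pairing0.
  - by rewrite pairingD.
  - by have [_ [_ g1 _]] := sG _ xs; rewrite pairingZ g1 mulr1.
have ltD x : x \in s -> x.1 < D%:R.
  move=> xs; have [_ /extreme_ray_lattice[d [m' [dD Sd latE]]]] := sG _ xs.
  have : (d%:R : rat) <= D%:R by case/andP: dD => _; rewrite ler_nat.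
  apply: lt_le_trans; rewrite ltNge; apply/negP => dx; apply: small.
  by exists x, d, m'.
(* The strict bound on the sum requires at least one summand. *)
have s_gt0 : (0 < size s)%N.
  rewrite lt0n size_eq0; apply/eqP => s0; move: kE; rewrite s0 big_nil => /eqP.
  by rewrite pnatr_eq0 gtn_eqF // (leq_ltn_trans _ Dk).
rewrite -(ltr_nat rat) kE (big_nth (0, 0)) natrM mulr_natl.
have -> : D%:R *+ size s = \sum_(0 <= i < size s) D%:R :> rat.
  by rewrite big_const_nat subn0 iter_addr_0.
by apply: ltr_sum_nat => // i /andP[_ is_]; apply: ltD; exact: mem_nth.
Qed.
End Generation.

(** * The bound on the symbolic generation type *)

Local Open Scope ereal_scope.

Theorem theorem6p9 (K : fieldType) (n : nat) (R : realType)
    (I : set {mpoly K[n]})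
    (I_monomial : monomial_ideal I) (I_lin : linear_power_type I)
    (r : nat) (r_gt0 : (0 < r)%N) (v : 'I_r -> 'rV[R]_n)
    (v_vertices : vertices (symb_polyhedron R I) = range v) :
  let d := fun i => lcm_denominators (v i) in
  let D := (\max_(i < r) d i)%N in
  symb_gen_type R I <=
    maxe (symb_spread R I * D%:R%:E - 1) D%:R%:E.
Proof.
cbv zeta; set D := (\max_(i < r) _)%N.
have [C [w [C_antichain w_gt0 IE]]] := linear_power_typeP I_lin.
have d_le i : (lcm_denominators (v i) <= D)%N.
  exact: (leq_bigmax (F := fun i => lcm_denominators (v i))).
have le_D u : vertices (symb_polyhedron R I) u -> (lcm_denominators u <= D)%N.
  by rewrite v_vertices => -[i _ <-]; exact: d_le.
have D_gt0 : (0 < D)%N.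
  exact: leq_trans (lcm_denominators_gt0 _) (d_le (Ordinal r_gt0)).
have : D%:R%:E <= maxe (symb_spread R I * D%:R%:E - 1) D%:R%:E.
  by rewrite le_max lexx orbT.
have : symb_spread R I * D%:R%:E - 1 <=
    maxe (symb_spread R I * D%:R%:E - 1) D%:R%:E.
  by rewrite le_max lexx.
(* The value [-oo] is excluded by [D], and [+oo] bounds everything. For a real [x] its integer part
   is an admissible generating degree. *)
case: (maxe _ _) => [x spread_x D_x|_ _|//]; last by rewrite leey.
have {}D_x : (D%:R <= x)%R by rewrite -lee_fin.
have x_ge0 : (0 <= x)%R by exact: le_trans D_x.
have D_le : (D <= Num.truncn x)%N by rewrite truncn_ge_nat.
apply: (@le_trans _ _ (Num.truncn x)%:R%:E); last first.
  by rewrite lee_fin truncn_le.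
apply: ereal_inf_lbound; exists (Num.truncn x) => //.
split; first exact: leq_trans D_le.
have powE := symb_powE C_antichain w_gt0 IE.
rewrite (symb_reesE C_antichain w_gt0 IE).
rewrite (@rees_generated K n _ (symb_mon0 w) (@symb_monD n C w) (Num.truncn x)).
  by congr subalg_gen; apply/seteqP; split=> p [k [a [kd ka pE]]];
    exists k, a; split=> //; move: ka; rewrite powE.
move=> k m Skm k_gt.
case: (symb_mon_decompose C_antichain w_gt0 IE le_D Skm (leq_ltn_trans D_le k_gt)).
- by left.
- by right.
(* Integrality turns [k < s * D] into [k <= s * D - 1], which is at most [x], against [k] exceeding
   the integer part of [x]. *)
- move=> [s s_le ks]; exfalso; move: k_gt; apply/negP; rewrite -leqNgt truncn_ge_nat //.
  rewrite -lee_fin; apply: le_trans spread_x.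
  apply: (@le_trans _ _ (s%:R%:E * D%:R%:E - 1)); last first.
    by rewrite leeD2r // lee_wpmul2r // lee_fin.
  by rewrite -EFinM -EFinB lee_fin lerBrDr natr1 -natrM ler_nat.
Qed.
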